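(* Let $R$ be a unital ring and $a,b\in R$. Then the following are equivalent: (1) there exists $y\in R$ such that $aya=a$, $yay=y$ and $yR=bR$; (2) $a$ is regular, $aR=abR$ and $(ab)^{\circ}=b^{\circ}$; (3) $a$ is regular and $R=a^{\circ}\oplus bR$.
   Context: For $x\in R$: $xR=\{xr\mid r\in R\}$, $x^{\circ}=\{r\in R\mid xr=0\}$. An element $x\in R$ is regular if there exists $z\in R$ with $xzx=x$. The symbol $\oplus$ denotes the internal direct sum of right ideals (sum equal to $R$, intersection $\{0\}$). *)

(* Defs.v *)
From mathcomp Require Import all_boot all_order all_algebra.
From mathcomp Require Import boolp classical_sets.

Set Implicit Arguments.
Unset Strict Implicit.
Unset Printing Implicit Defensive.

Import GRing.Theory.
Local Open Scope classical_set_scope.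
Local Open Scope ring_scope.

(* Rings are associative, unital, not necessarily commutative, and possibly
   trivial (pzRingType, rather than nzRingType). *)

(* xR *)
Definition rprincipal (R : pzRingType) (x : R) : set R :=
  [set x * r | r in [set: R]].

(* The right annihilator, usually written with a circle as an exponent of x. *)
Definition rann (R : pzRingType) (x : R) : set R :=
  [set r : R | x * r = 0].

(* Von Neumann regularity; unrelated to GRing.lreg, GRing.rreg, which are about
   cancellability, and to GRing.regular, the regular algebra. *)
Definition vn_regular (R : pzRingType) (x : R) : Prop :=
  exists z : R, x * z * x = x.

(* R = A (+) B, for right ideals A and B of R. *)
Definition ring_direct_sum (R : pzRingType) (A B : set R) : Prop :=
  [set u + v | u in A & v in B] = [set: R] /\ A `&` B = [set 0].

(* Main.v *)
Require Import Defs.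
From mathcomp Require Import all_boot all_order all_algebra.
From mathcomp Require Import boolp classical_sets.

(** Everything rests on viewing left multiplication by [a] as a map
    [R -> aR] of right modules, with kernel [rann a], and on the principal right
    ideal [bR].  The conditions [aR = abR] and [rann (a * b) = rann b] say
    respectively that [bR] already covers the whole image [aR] and that [a] acts
    injectively on [bR]; together they say that [bR] is a complement of the
    kernel, which is the direct sum decomposition.

    If [y] is a reflexive inverse of [a] with [yR = bR], then left
    multiplication by [y], restricted to [aR], is a section of this map with
    image [bR], so both conditions hold.  Conversely, given the
    decomposition, let [b * s] be the component of [1] in [bR], so that
    [a * (b * s) = a], and let [z] be any inner inverse of [a]; the inverse is
    [y = b * s * z].  The identities [y * a * y = y] and [y * a * b = b] hold
    because both sides lie in [bR] and have the same image under [a]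
    ([injective_on_complement]). *)

Import GRing.Theory.
Local Open Scope classical_set_scope.
Local Open Scope ring_scope.

Lemma rprincipal_subset (R : pzRingType) (x y : R) :
  (rprincipal x `<=` rprincipal y) <-> (exists r, x = y * r).
Proof.
split=> [sub | [r ->] _ [t _ <-]]; last by exists (r * t); rewrite // mulrA.
have [|r _ <-] := sub x; first by exists 1; rewrite // mulr1.
by exists r.
Qed.

Lemma rprincipal_eq (R : pzRingType) (x y : R) :
  rprincipal x = rprincipal y <->
  (exists r, x = y * r) /\ (exists r, y = x * r).
Proof. by rewrite -!rprincipal_subset eqEsubset. Qed.

(** The right ideals [rann a] and [bR] meet trivially exactly when [a] does not
    kill a nonzero element of [bR]; by subtracting, [a] separates the elements
    of [bR]. *)
Lemma injective_on_complement (R : pzRingType) (a b r t : R) :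
  rann a `&` rprincipal b = [set 0] -> a * (b * r) = a * (b * t) ->
  b * r = b * t.
Proof.
move=> cap0 eq_a; apply/eqP; rewrite -subr_eq0; apply/eqP.
suff : (rann a `&` rprincipal b) (b * r - b * t) by rewrite cap0.
split; first by rewrite /rann /= mulrBr eq_a subrr.
by exists (r - t); rewrite // mulrBr.
Qed.

(** From [a = a * b * s] one gets [1 = (1 - b * s) + b * s] with [a] killing the
    first term; multiplying by [x] on the right decomposes every [x].  The
    annihilator condition makes [a] injective on [bR], hence the zero
    intersection. *)
Lemma ring_direct_sum_of_covering (R : pzRingType) (a b : R) :
  (exists s, a = a * b * s) -> rann (a * b) = rann b ->
  ring_direct_sum (rann a) (rprincipal b).
Proof.
move=> [s aE] annE; split.
  rewrite -subTset => x _.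
  exists (x - b * (s * x)); last first.
    by exists (b * (s * x)); [exists (s * x) | rewrite subrK].
  by rewrite /rann /= mulrBr !mulrA -aE subrr.
rewrite eqEsubset; split=> [_ [/[swap] -[r _ <-]] | _ ->]; last first.
  by split; [exact: mulr0 | exists 0; rewrite // mulr0].
rewrite /rann /= mulrA => abr0.
by have : rann b r by rewrite -annE.
Qed.

Lemma reflexive_inverse_of_direct_sum (R : pzRingType) (a b : R) :
  vn_regular a -> ring_direct_sum (rann a) (rprincipal b) ->
  exists y : R,
    [/\ a * y * a = a, y * a * y = y & rprincipal y = rprincipal b].
Proof.
move=> [z azaE] [sumT cap0].
have [u au0 [_ [s _ <-] onE]] : [set u + v | u in rann a & v in rprincipal b] 1.
  by rewrite sumT.
have aE : a * (b * s) = a.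
  by rewrite -[RHS]mulr1 -onE mulrDr (au0 : a * u = 0) add0r.
have ayE : a * (b * (s * z)) = a * z by rewrite (mulrA b) mulrA aE.
exists (b * (s * z)); split; first by rewrite ayE.
  rewrite -!(mulrA b); apply: injective_on_complement cap0 _.
  by rewrite !(mulrA b) !mulrA -(mulrA a) aE -!mulrA ayE !mulrA azaE.
apply/rprincipal_eq; split; first by exists (s * z).
exists (a * b); rewrite -(mulrA b) -{1}[b]mulr1.
apply: injective_on_complement cap0 _.
by rewrite mulr1 (mulrA b) mulrA ayE mulrA azaE.
Qed.

Theorem theorem3p14 (R : pzRingType) (a b : R) :
  [<-> exists y : R,
         [/\ a * y * a = a, y * a * y = y & rprincipal y = rprincipal b];
       [/\ vn_regular a, rprincipal a = rprincipal (a * b)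
         & rann (a * b) = rann b];
       vn_regular a /\ ring_direct_sum (rann a) (rprincipal b)].
Proof.
tfae.
- move=> [y [ayaE yayE /rprincipal_eq[[s yE] [t bE]]]]; split.
  + by exists y.
  + apply/rprincipal_eq; split; last by exists b.
    by exists (s * a); rewrite mulrA -(mulrA a) -yE.
  + rewrite eqEsubset; split=> r; rewrite /rann /= => r0; last first.
      by rewrite -mulrA r0 mulr0.
    have yabE : y * a * b = b by rewrite bE mulrA yayE.
    by rewrite -yabE -!mulrA (mulrA a) r0 mulr0.
- move=> [areg /rprincipal_eq[cover _] annE]; split=> //.
  exact: ring_direct_sum_of_covering.
- by move=> [areg dsum]; apply: reflexive_inverse_of_direct_sum.
Qed.
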